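(* Let $V_1,\dots,V_N$ be finite-dimensional real vector spaces, each carrying a scalar product $\langle\cdot,\cdot\rangle_{V_j}$, and let $V=\bigoplus_{j=1}^N V_j$ with the scalar product $\langle\cdot,\cdot\rangle_V=\bigoplus_{j}\langle\cdot,\cdot\rangle_{V_j}$. Let $\mathcal L\subset\mathfrak o(V,\langle\cdot,\cdot\rangle_V)$ be a semisimple Lie subalgebra that admits a Chevalley basis $\mathcal C_{\mathcal L}$ such that the structure constants with respect to this basis are rational, and let $W$ be a rational subspace of $\mathcal L$ relative to the rational structure $\mathrm{span}_{\mathbb Q}\{\mathcal C_{\mathcal L}\}$, such that the form $-\mathrm{tr}(zz')$ is non-degenerate on $W$. Assume that each $V_j$ is preserved by $W$ (so that elements of $W$ act as elements of $\mathrm{End}(V_j)$ by restriction), that each $V_j$ is $W$-irreducible, and that each $\langle\cdot,\cdot\rangle_{V_j}$ is $W$-invariant. Assume moreover that for each $j$ there is a basis $B_{V_j}$ of $V_j$ such that $\zeta(\mathrm{span}_{\mathbb Q}\{B_{V_j}\})\subset \mathrm{span}_{\mathbb Q}\{B_{V_j}\}$ for all $\zeta\in\mathcal C_{\mathcal L}$. Then there exists a scalar product $\langle\cdot,\cdot\rangle_{\mathcal G}$ on $V\oplus W$ such that the standard pseudo-metric 2-step nilpotent Lie algebra $\mathcal G=(V\oplus W,[\cdot,\cdot],\langle\cdot,\cdot\rangle_{\mathcal G})$ admits a basis with rational structure constants.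
   Context: A scalar product is a non-degenerate symmetric real bilinear form. $\mathfrak o(V,\langle\cdot,\cdot\rangle_V)$ is the space of linear maps $A\colon V\to V$ with $\langle Av,w\rangle_V=-\langle v,Aw\rangle_V$. For a set $W$ of linear maps on a space $U$, a scalar product on $U$ is $W$-invariant if all elements of $W$ are skew-symmetric with respect to it, and $U$ is $W$-irreducible if no proper nonzero subspace of $U$ is invariant under all elements of $W$. ''Chevalley basis'' is the paper's name for a basis of a real semisimple Lie algebra, obtained from a Chevalley basis of the complexification, with respect to which the structure constants are rational (in $\frac12\mathbb Z$); only rationality of the structure constants is relevant. A subspace $W\subset\mathcal L$ is rational relative to $\mathrm{span}_{\mathbb Q}\{\mathcal C_{\mathcal L}\}$ if $W$ has a basis contained in $\mathrm{span}_{\mathbb Q}\{\mathcal C_{\mathcal L}\}$. Given a scalar product $\langle\cdot,\cdot\rangle_V^*$ on $V$ and a subspace $W\subset\mathfrak o(V,\langle\cdot,\cdot\rangle_V^* )$ on which $\langle z,z'\rangle=-\mathrm{tr}(zz')$ is non-degenerate, the standard pseudo-metric 2-step nilpotent Lie algebra is $\mathcal G=V\oplus W$ with scalar product $\langle\cdot,\cdot\rangle_{\mathcal G}$ the orthogonal sum of $\langle\cdot,\cdot\rangle_V^*$ and $-\mathrm{tr}(zz')$ on $W$, and with bracket such that $W$ is contained in the centre and for $v,w\in V$, $[v,w]\in W$ is the unique element with $-\mathrm{tr}([v,w]z)=\langle z(v),w\rangle_V^*$ for all $z\in W$. *)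

(* Defs.v *)
From HB Require Import structures.
From mathcomp Require Import all_boot all_order all_algebra.
From mathcomp Require Import boolp classical_sets reals.

Set Implicit Arguments.
Unset Strict Implicit.
Unset Printing Implicit Defensive.

Import GRing.Theory.

Local Open Scope classical_set_scope.
Local Open Scope ring_scope.

Section Forms.
Variables (R : realType) (U : vectType R).

Definition skew_for (b : U -> U -> R) (z : 'End(U)) : Prop :=
  forall v w, b (z v) w = - b v (z w).

Definition invariant_form (S : set 'End(U)) (b : U -> U -> R) : Prop :=
  forall z, S z -> skew_for b z.

Definition irreducible_for (S : set 'End(U)) : Prop :=
  forall X : {vspace U},
    (forall z, S z -> (z @: X <= X)%VS) -> X = 0%VS \/ X = fullv.

Definition lftrace (z : 'End(U)) : R :=
  \tr (passmx.mxof (vbasis fullv) (vbasis fullv) z).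

End Forms.

Section Rationality.
Variables (R : realType) (U : vectType R).

Definition spanQ (e : seq U) : set U :=
  [set v | exists c : 'I_(size e) -> rat,
     v = \sum_(i < size e) ratr (c i) *: e`_i].

(* Meaningful when e is free and br e`_i e`_j lies in its span. *)
Definition rational_structure_constants (br : U -> U -> U)
    (n : nat) (e : n.-tuple U) : Prop :=
  forall i j k : 'I_n, rational (coord e k (br e`_i e`_j)).

Definition rational_subspace (e : seq U) (X : {vspace U}) : Prop :=
  exists (n : nat) (x : n.-tuple U),
    basis_of X x /\ (forall i : 'I_n, spanQ e x`_i).

End Rationality.

Section LieSubalgebras.
Variables (R : realType) (U : vectType R).
Implicit Types (x y : 'End(U)) (L I : {vspace 'End(U)}).

Definition lfbracket x y : 'End(U) := (x \o y - y \o x)%VF.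

Definition lie_subalgebra L : Prop :=
  {in L &, forall x y, lfbracket x y \in L}.

Definition lie_ideal L I : Prop :=
  (I <= L)%VS /\ {in L & I, forall x y, lfbracket x y \in I}.

Definition lie_derived I : {vspace 'End(U)} :=
  <<[seq lfbracket x y | x <- vbasis I, y <- vbasis I]>>%VS.

Definition lie_solvable I : Prop := exists n, iter n lie_derived I = 0%VS.

(* Vanishing radical: every solvable ideal of L is zero (L = 0 is allowed). *)
Definition lie_semisimple L : Prop :=
  forall I, lie_ideal L I -> lie_solvable I -> I = 0%VS.

End LieSubalgebras.

Section DirectSums.
Variables (R : realType) (V : vectType R).

(* The compression of z to X, which is the restriction of z to X as soon as
   z preserves X. *)
Definition restrict (X : {vspace V}) (z : 'End(V)) : 'End(subvs_of X) :=
  (linfun (vsproj X) \o z \o linfun vsval)%VF.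

(* The orthogonal sum of forms on the summands of an internal direct sum
   V = \sum_j Vs j. *)
Definition orthogonal_sum (N : nat) (Vs : 'I_N -> {vspace V})
    (b : forall j, subvs_of (Vs j) -> subvs_of (Vs j) -> R) (v w : V) : R :=
  let pr j := vsproj (Vs j)
    \o sumv_pi_for (erefl (\sum_(i < N) Vs i)%VS) j in
  \sum_(j < N) b j (pr j v) (pr j w).

End DirectSums.

Section TraceForm.
Variables (R : realType) (V : vectType R) (W : {vspace 'End(V)}).

Definition trform (z z' : subvs_of W) : R :=
  - lftrace (vsval z \o vsval z')%VF.

Fact trform_bilinear : bilinear_for *%R *%R trform.
Proof.
split=> [z' a z1 z2|z a z1 z2]; rewrite /trform /lftrace linearP/=.
  by rewrite comp_lfunDl -comp_lfunZl passmx.mxof_linear mxtraceD mxtraceZ opprD mulrN.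
by rewrite comp_lfunDr -comp_lfunZr passmx.mxof_linear mxtraceD mxtraceZ opprD mulrN.
Qed.
HB.instance Definition _ := bilinear_isBilinear.Build R
  (subvs_of W) (subvs_of W) R *%R (idfun \; *%R) trform trform_bilinear.

Fact trform_sym z z' : trform z z' = (-1) ^+ false * idfun (trform z' z).
Proof.
rewrite expr0 mul1r /trform /lftrace.
by rewrite !(passmx.mxof_comp _ _ (vbasisP _)) mxtrace_mulC.
Qed.
HB.instance Definition _ := isHermitianSesquilinear.Build R
  (subvs_of W) false idfun trform trform_sym.

End TraceForm.

Arguments trform {R V} W z z'.

Section StandardAlgebra.
Variables (R : realType) (V : vectType R) (W : {vspace 'End(V)}).
Local Notation G := (V * subvs_of W)%type.

Definition alternating (br : G -> G -> G) : Prop := forall x, br x x = 0.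

Definition jacobi (br : G -> G -> G) : Prop :=
  forall x y z, br x (br y z) + br y (br z x) + br z (br x y) = 0.

(* (G, br, g) is the standard pseudo-metric 2-step nilpotent Lie algebra
   attached to W and to some scalar product bV on V for which W consists of
   skew-symmetric maps. Since trform W is nondegenerate, the last two
   conditions determine br from bV. *)
Definition standard_pmetric_algebra
    (g : {symmetric G}) (br : {bilinear G -> G -> G}) : Prop :=
  exists bV : {symmetric V},
    [/\ nondegenerate bV,
        forall z, z \in W -> skew_for bV z,
        nondegenerate (trform W) &
        forall x y, g x y = bV x.1 y.1 + trform W x.2 y.2] /\
    [/\ alternating br,
        jacobi br,
        forall (z : subvs_of W) (x : G), br (0, z) x = 0 &
        forall v w : V, (br (v, 0) (w, 0)).1 = 0 /\
          forall z : subvs_of W,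
            trform W (br (v, 0) (w, 0)).2 z = bV (vsval z v) w].

End StandardAlgebra.

(* Main.v *)
Require Import Defs.
From HB Require Import structures.
From mathcomp Require Import all_boot all_order all_algebra.
From mathcomp Require Import boolp classical_sets reals.

Set Implicit Arguments.
Unset Strict Implicit.
Unset Printing Implicit Defensive.

Import GRing.Theory passmx.

Local Open Scope classical_set_scope.
Local Open Scope ring_scope.

(** The given scalar product on [V] need not have rational values on the
    rational structure, but it can be traded for one that has.

    The bases of the [Vs j] join to a basis [B] of [V], and a rational basis of
    [W] acts on [V] by matrices [A k] that are rational in [B]. A symmetric form
    with Gram matrix [X] is [W]-invariant if and only if
    [A k *m X = - (X *m (A k)^T)] for all [k]: a homogeneous linear system with
    rational coefficients. The Gram matrix of the orthogonal sum of the [b j] is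
    an invertible real solution. Expanding its entries in a basis of their span
    over the rationals decomposes it into rational solutions
    ([rat_free_decomposition]). The determinant of a combination of these is a
    polynomial in the coefficients which is not identically zero, hence is
    nonzero for some rational coefficients. This produces a nondegenerate
    [W]-invariant form [bV] with rational Gram matrix
    ([rational_invariant_gram]).

    The bracket defined by [bV] then has rational structure constants
    ([rational_basis_prod]): in the basis formed by [B] and a rational basis
    [E] of [W], the values [bV (E_l B_a) B_c] are rational, as is the Gram
    matrix of the trace form, whose entries are, up to sign, traces of products
    of the [A k]; the coordinates of a bracket come from the former by applying
    the inverse of the latter. *)

(** * Rational solutions of linear systems on matrices *)

Section RationalSolutions.
Variable F : numFieldType.

Local Notation ratr_mx := (map_mx (ratr : rat -> F)).

Definition rat_free k (a : 'I_k -> F) : Prop :=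
  forall c : 'I_k -> rat,
    \sum_(i < k) ratr (c i) * a i = 0 -> forall i, c i = 0.

Lemma rat_free_matrix_sum k (a : 'I_k -> F) m n (S : 'I_k -> 'M[rat]_(m, n)) :
  rat_free a -> \sum_(i < k) a i *: ratr_mx (S i) = 0 -> forall i, S i = 0.
Proof.
move=> a_free sum0 i; apply/matrixP=> r c; rewrite mxE.
apply: (a_free (fun i => S i r c)).
move/matrixP/(_ r c): sum0; rewrite summxE [RHS]mxE => sum0.
by rewrite -[RHS]sum0; apply: eq_bigr => j _; rewrite !mxE mulrC.
Qed.

(** As long as the coefficients [a i] satisfy a rational relation, one of them
    is a rational combination of the others, so that it can be eliminated at
    the cost of changing the rational matrices. *)
Lemma rat_free_decomposition_of_sum k (a : 'I_k -> F) m n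
    (S : 'I_k -> 'M[rat]_(m, n)) :
  exists p (a' : 'I_p -> F) (S' : 'I_p -> 'M[rat]_(m, n)), rat_free a' /\
    \sum_(i < k) a i *: ratr_mx (S i) = \sum_(i < p) a' i *: ratr_mx (S' i).
Proof.
elim: k => [|k IHk] in a S *.
  by exists 0%N, a, S; split=> // c _ [].
have [a_free|] := pselect (rat_free a); first by exists k.+1, a, S.
move=> /existsNP[c /not_implyP[rel_c /existsNP[j /eqP cj_neq0]]].
(* Solving the relation [c] for [a j], whose coefficient is nonzero. *)
have cjF_neq0 : (ratr (c j) : F) != 0 by rewrite fmorph_eq0.
have aj : a j = \sum_(i < k) ratr (- c (lift j i) / c j) * a (lift j i).
  move: rel_c; rewrite (bigD1_ord j) //= => /eqP.
  rewrite addr_eq0 => /eqP rel_c; apply: (mulfI cjF_neq0).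
  rewrite rel_c mulr_sumr -sumrN.
  apply: eq_bigr => i _; rewrite rmorphM rmorphN fmorphV /= mulrA.
  by rewrite mulrCA divff // mulr1 mulNr.
have [p [a' [S' [a'_free eqS']]]] := IHk (fun i => a (lift j i))
  (fun i => S (lift j i) - (c (lift j i) / c j) *: S j).
exists p, a', S'; split=> //; rewrite -eqS' (bigD1_ord j) //= {1}aj.
rewrite scaler_suml -big_split; apply: eq_bigr => i _ /=.
rewrite raddfB /= map_mxZ scalerBr scalerA mulNr !rmorphN /= mulNr.
by rewrite scaleNr mulrC addrC.
Qed.

(** The entries of [X] span a finite-dimensional rational vector space, and
    [a] can be taken as a basis of it. What this buys: every homogeneous linear
    equation with rational coefficients that holds for [X] holds for each
    [S i], by [rat_free_matrix_sum]. *)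
Lemma rat_free_decomposition m n (X : 'M[F]_(m, n)) :
  exists p (a : 'I_p -> F) (S : 'I_p -> 'M[rat]_(m, n)),
    rat_free a /\ X = \sum_(i < p) a i *: ratr_mx (S i).
Proof.
have [p [a [S [a_free eqX]]]] := rat_free_decomposition_of_sum
  (fun k : 'I_#|{: 'I_m * 'I_n}| => X (enum_val k).1 (enum_val k).2)
  (fun k => delta_mx (enum_val k).1 (enum_val k).2).
exists p, a, S; split=> //; rewrite -eqX {1}[X]matrix_sum_delta pair_bigA /=.
rewrite (reindex _ (onW_bij _ (@enum_val_bij {: 'I_m * 'I_n}))) /=.
by apply: eq_bigr => k _; rewrite map_delta_mx.
Qed.

Lemma polynomial_rational_nonroot (P : {poly F}) :
  P != 0 -> exists c : rat, P.[ratr c] != 0.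
Proof.
move=> P_neq0; apply: contrapT => /forallNP rootP.
set rs : seq F := [seq ratr i%:R | i <- iota 0 (size P)].
suff: (size rs < size P)%N by rewrite size_map size_iota ltnn.
apply: max_poly_roots => //.
- by apply/allP=> _ /mapP[i _ ->]; apply/negPn/negP => /rootP.
- rewrite map_inj_uniq ?iota_uniq // => i j /fmorph_inj/eqP.
  by rewrite Num.Theory.eqr_nat => /eqP.
Qed.

(** As a function of [a], the determinant is a polynomial which is not
    identically zero, so it vanishes at only finitely many rationals. *)
Lemma det_rational_perturbation n (M B : 'M[F]_n) (a : F) :
  \det (M + a *: B) != 0 -> exists c : rat, \det (M + ratr c *: B) != 0.
Proof.
pose P := \det (map_mx polyC M + 'X *: map_mx polyC B).
have PE x : P.[x] = \det (M + x *: B).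
  rewrite -horner_evalE -det_map_mx; congr (\det _); apply/matrixP => i j.
  by rewrite !mxE /= horner_evalE !hornerE.
rewrite -PE => Pa_neq0.
have [|c] := @polynomial_rational_nonroot P; last by rewrite PE; exists c.
by apply: contraNneq Pa_neq0 => ->; rewrite horner0.
Qed.

(** The coefficients [a i] are replaced by rational ones one at a time; [M]
    collects the terms already treated, which keeps the induction going. *)
Lemma det_rational_combination n p (S : 'I_p -> 'M[rat]_n) (a : 'I_p -> F)
    (M : 'M[rat]_n) :
  \det (ratr_mx M + \sum_(i < p) a i *: ratr_mx (S i)) != 0 ->
  exists c : 'I_p -> rat, \det (M + \sum_(i < p) c i *: S i) != 0.
Proof.
elim: p => [|p IHp] in S a M *.
  rewrite !big_ord0 !addr0 det_map_mx fmorph_eq0 => detM.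
  by exists (fun=> 0); rewrite big_ord0 addr0.
rewrite big_ord_recr /= addrA => /det_rational_perturbation[c0].
rewrite addrAC -map_mxZ -map_mxD => /IHp[c det_c].
exists (fun i => if unlift ord_max i is Some j then c j else c0).
rewrite big_ord_recr /= unlift_none addrCA addrC.
rewrite (eq_bigr (fun i => c i *: S (widen_ord (leqnSn p) i))) 1?addrA //.
move=> i _; have -> : widen_ord (leqnSn p) i = lift ord_max i.
  by apply: val_inj; rewrite /= /bump leqNgt ltn_ord.
by rewrite liftK.
Qed.

(** In matrix terms, an invertible symmetric solution over [F] of the linear
    system that says that all [A i] are skew-symmetric yields a rational one.
    The system has rational coefficients, so the rational components [S k] of
    [X] solve it, and so does any combination of them; as the determinant does
    not vanish at the combination [X], some rational combination is
    invertible. *)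
Lemma rational_invariant_gram n (I : Type) (A : I -> 'M[rat]_n)
    (X : 'M[F]_n) :
  X^T = X -> (forall i, ratr_mx (A i) *m X = - (X *m (ratr_mx (A i))^T)) ->
  X \in unitmx ->
  exists S : 'M[rat]_n,
    [/\ S^T = S, forall i, A i *m S = - (S *m (A i)^T) & S \in unitmx].
Proof.
move=> X_sym X_inv X_unit.
have [p [a [S [a_free eqX]]]] := rat_free_decomposition X.
have S_sym k : (S k)^T = S k.
  apply/eqP; rewrite -subr_eq0; apply/eqP; move: k.
  apply: (rat_free_matrix_sum a_free).
  rewrite -[RHS](subrr X) -{1}X_sym eqX raddf_sum /= -sumrB.
  apply: eq_bigr => k _.
  by rewrite raddfB /= scalerBr !linearZ /= map_trmx.
have S_inv i k : A i *m S k = - (S k *m (A i)^T).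
  apply/eqP; rewrite -addr_eq0; apply/eqP; move: k.
  apply: (rat_free_matrix_sum a_free).
  rewrite -[RHS](addNr (X *m (ratr_mx (A i))^T)) -X_inv eqX.
  rewrite mulmx_sumr mulmx_suml -big_split; apply: eq_bigr => k _ /=.
  by rewrite raddfD /= !map_mxM map_trmx scalerDr scalemxAr scalemxAl.
have [|c det_c] := @det_rational_combination n p S a 0.
  by rewrite raddf0 add0r -eqX -unitfE -unitmxE.
exists (\sum_(i < p) c i *: S i); split.
- by rewrite raddf_sum; apply: eq_bigr => k _; rewrite /= linearZ /= S_sym.
- move=> i; rewrite mulmx_sumr mulmx_suml -sumrN; apply: eq_bigr => k _ /=.
  by rewrite -scalemxAr S_inv scalerN scalemxAl.
- by rewrite unitmxE unitfE -[X in \det X]add0r.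
Qed.

End RationalSolutions.

(** * Symmetric forms and their Gram matrices *)

Section SymmetricForms.
Variables (F : fieldType) (U : vectType F).
Implicit Types (f : {symmetric U}) (u v : U).

Lemma symmetric_formC f u v : f u v = f v u.
Proof. by rewrite (hermC f) /= expr0 mul1r. Qed.

Lemma nondegenerateP f :
  reflect (forall u, (forall v, f u v = 0) -> u = 0) (nondegenerate f).
Proof.
apply: (iffP idP) => [/eqP rad0 u u_rad|rad0]; last first.
  apply/eqP/vspaceP=> u; rewrite memv0; apply/mem_orthovP/eqP=> [u_rad|-> v _].
    by apply: rad0 => v; rewrite u_rad ?memvf.
  by rewrite linear0l.
by apply/eqP; rewrite -memv0 -rad0; apply/mem_orthovP => v _.
Qed.

End SymmetricForms.

Lemma symmetric_form_exists (F : fieldType) (U : vectType F) (f : U -> U -> F) :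
  (forall v, scalar (f^~ v)) -> (forall u v, f u v = f v u) ->
  exists fS : {symmetric U}, forall u v, fS u v = f u v.
Proof.
move=> f_lin f_symC.
have f_bil : bilinear_for *%R *%R f.
  split=> [v a u1 u2|u a v1 v2] /=; first exact: f_lin.
  by rewrite !(f_symC u) f_lin.
have f_sym u v : f u v = (-1) ^+ false * idfun (f v u).
  by rewrite expr0 mul1r f_symC.
pose fB := bilinear_isBilinear.Build F U U F *%R (idfun \; *%R) f f_bil.
pose fH := isHermitianSesquilinear.Build F U false idfun f f_sym.
by pose fS : {symmetric U} := HB.pack f fB fH; exists fS.
Qed.

Section GramMatrices.
Variables (F : fieldType) (U : vectType F) (e : (\dim {:U}).-tuple U).
Hypothesis e_basis : basis_of {:U} e.
Implicit Types (f : {symmetric U}) (u v : U).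

Local Notation rV := (rVof e).
Local Notation mx := (mxof e e).

Definition gram f : 'M[F]_(\dim {:U}) := \matrix_(i, j) f e`_i e`_j.

Lemma formE f u v : f u v = (rV u *m gram f *m (rV v)^T) 0 0.
Proof.
rewrite [u in LHS](coord_basis e_basis) ?memvf //.
rewrite [v in LHS](coord_basis e_basis) ?memvf //.
rewrite mxE linear_sumr; apply: eq_bigr => j _.
rewrite linearZr /= linear_sumlz !mxE mulrC; congr (_ * _).
apply: eq_bigr => i _.
by rewrite !mxE linearZl_LR.
Qed.

Lemma delta_form n (M : 'M[F]_n) i j :
  ((delta_mx 0 i : 'rV_n) *m M *m (delta_mx 0 j : 'rV_n)^T) 0 0 = M i j.
Proof. by rewrite -rowE trmx_delta -colE !mxE. Qed.

Lemma gram_sym f : (gram f)^T = gram f.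
Proof. by apply/matrixP=> i j; rewrite !mxE symmetric_formC. Qed.

Lemma nondegenerate_gram f : nondegenerate f = (gram f \in unitmx).
Proof.
apply/nondegenerateP/idP => [rad0|gram_unit u u_rad].
  rewrite -row_free_unit -kermx_eq0; apply/eqP/row_matrixP => i.
  rewrite row0; set w := row i _.
  have w0 : w *m gram f = 0 by apply/sub_kermxP; apply: row_sub.
  rewrite -[w](vecofK e_basis); apply/eqP.
  rewrite rVof_eq0 //; apply/eqP/rad0 => v.
  by rewrite formE vecofK // w0 mul0mx mxE.
apply/eqP; rewrite -(rVof_eq0 e_basis) -[rV u](mulmxK gram_unit).
suff -> : rV u *m gram f = 0 by rewrite mul0mx.
apply/rowP => j; rewrite [RHS]mxE -[RHS](u_rad e`_j) formE rVofE //.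
by rewrite trmx_delta -colE [RHS]mxE.
Qed.

(** Coordinates are row vectors on which matrices act from the right, which is
    why [z] in the second argument of [f] gives the transpose. *)
Lemma skew_gram f (z : 'End(U)) :
  (forall u v, f (z u) v = - f u (z v)) <->
  mx z *m gram f = - (gram f *m (mx z)^T).
Proof.
split=> [z_skew|z_skew u v]; last first.
  rewrite !formE !(rVof_app e e_basis) trmx_mul -(mulmxA (rV u)) z_skew.
  by rewrite mulmxN mulNmx [LHS]mxE !mulmxA.
apply/matrixP=> i j; have := z_skew e`_i e`_j.
rewrite !formE !(rVof_app e e_basis) !rVofE // trmx_mul.
rewrite -(mulmxA (delta_mx 0 i)) mulmxA -(mulmxA (delta_mx 0 i)) !delta_form.
by rewrite mulmxA -(mulmxA (delta_mx 0 i)) delta_form => ->; rewrite [RHS]mxE.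
Qed.

Lemma form_of_gram (M : 'M[F]_(\dim {:U})) :
  M^T = M -> exists f, gram f = M.
Proof.
move=> M_sym; pose f u v : F := (rV u *m M *m (rV v)^T) 0 0.
have [||fS fSE] := @symmetric_form_exists F U f.
- by move=> v a u1 u2; rewrite /f linearP 2!mulmxDl -!scalemxAl !mxE.
- move=> u v; rewrite /f.
  have <- : (rV v *m M *m (rV u)^T)^T = rV u *m M *m (rV v)^T.
    by rewrite !trmx_mul trmxK M_sym mulmxA.
  by rewrite mxE.
exists fS; apply/matrixP=> i j; rewrite mxE fSE -[RHS]delta_form.
by rewrite -!(rVofE e_basis).
Qed.

End GramMatrices.

(** * Bases of subspaces and products *)

Lemma basis_tuple (F : fieldType) (U : vectType F) (X : {vspace U})
    (s : seq U) :
  basis_of X s -> exists e : (\dim X).-tuple U, e = s :> seq U.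
Proof.
move=> s_basis; have /eqP sz : size s == \dim X.
  by rewrite (@size_basis _ _ X _ (in_tuple s)).
by rewrite -sz; exists (in_tuple s).
Qed.

Lemma basis_vsproj (F : fieldType) (U : vectType F) (X : {vspace U})
    (s : seq U) :
  basis_of X s -> basis_of {:subvs_of X} [seq vsproj X v | v <- s].
Proof.
move=> s_basis; rewrite basisEdim size_map dimvf.
rewrite [X in _ && X](_ : _ = true) ?andbT; last first.
  by apply: eq_leq; rewrite -(@size_basis _ _ X _ (in_tuple s)).
apply/subvP=> u _; rewrite -(vsvalK u).
rewrite (coord_basis (X := in_tuple s) s_basis (subvsP u)) linear_sum.
apply: memv_suml => i _; rewrite linearZ memvZ //=.
by apply/memv_span/map_f/mem_nth.
Qed.

Section ProductSpace.
Variables (F : fieldType) (U1 U2 : vectType F).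

Definition inl_prod (v : U1) : U1 * U2 := (v, 0).
Definition inr_prod (x : U2) : U1 * U2 := (0, x).

Lemma inl_prod_linear : linear inl_prod.
Proof. by move=> a v w; congr pair; rewrite /= scaler0 addr0. Qed.
HB.instance Definition _ := GRing.isLinear.Build F U1 (U1 * U2)%type *:%R
  inl_prod inl_prod_linear.

Lemma inr_prod_linear : linear inr_prod.
Proof. by move=> a v w; congr pair; rewrite /= scaler0 addr0. Qed.
HB.instance Definition _ := GRing.isLinear.Build F U2 (U1 * U2)%type *:%R
  inr_prod inr_prod_linear.

Lemma basis_prod (s1 : seq U1) (s2 : seq U2) :
  basis_of {:U1} s1 -> basis_of {:U2} s2 ->
  basis_of {:(U1 * U2)%type} (map inl_prod s1 ++ map inr_prod s2).
Proof.
move=> s1_basis s2_basis; rewrite basisEdim size_cat !size_map.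
rewrite [X in _ && X](_ : _ = true) ?andbT; last first.
  apply: eq_leq; rewrite dimvf -(@size_basis _ _ _ _ (in_tuple s1) s1_basis).
  by rewrite -(@size_basis _ _ _ _ (in_tuple s2) s2_basis) !dimvf.
apply/subvP=> u _; have -> : u = inl_prod u.1 + inr_prod u.2.
  by case: u => v x; congr pair; rewrite /= ?addr0 ?add0r.
apply: memvD.
- rewrite (coord_basis (X := in_tuple s1) s1_basis (memvf u.1)) linear_sum.
  apply: memv_suml => i _; rewrite linearZ memvZ //=.
  by apply: memv_span; rewrite mem_cat map_f // mem_nth.
- rewrite (coord_basis (X := in_tuple s2) s2_basis (memvf u.2)) linear_sum.
  apply: memv_suml => i _; rewrite linearZ memvZ //=.
  by apply: memv_span; rewrite mem_cat orbC map_f // mem_nth.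
Qed.

End ProductSpace.

(** * Rational spans *)

Section RationalEntries.
Variables (R : realType).

Lemma rational_sum (I : finType) (c : I -> rat) (x : I -> R) :
  (forall i, rational (x i)) -> rational (\sum_i ratr (c i) * x i).
Proof.
move=> /(_ _)/cid2-/all_sig2[q _ qE]; exists (\sum_i c i * q i) => //.
by rewrite rmorph_sum; apply: eq_bigr => i _; rewrite rmorphM /= qE.
Qed.

Lemma rational_mx m n (M : 'M[R]_(m, n)) :
  (forall i j, rational (M i j)) ->
  exists M' : 'M[rat]_(m, n), M = map_mx ratr M'.
Proof.
move=> M_rat.
exists (\matrix_(i, j) sval (cid2 (M_rat i j))); apply/matrixP=> i j.
by rewrite !mxE; case: cid2.
Qed.

End RationalEntries.

Section RationalSpan.
Variables (R : realType) (U : vectType R).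
Implicit Types (s : seq U) (v : U).

Lemma spanQ_mem s v : v \in s -> spanQ s v.
Proof.
move=> /(nthP 0)[i lt_i <-]; exists (fun k => (k == Ordinal lt_i)%:R).
rewrite (bigD1 (Ordinal lt_i)) //= eqxx rmorph1 scale1r.
rewrite big1 ?addr0 // => k /negPf->.
by rewrite rmorph0 scale0r.
Qed.

Lemma spanQ_sum s (I : finType) (c : I -> rat) (x : I -> U) :
  (forall i, spanQ s (x i)) -> spanQ s (\sum_i ratr (c i) *: x i).
Proof.
move=> /choice[q xE]; exists (fun k => \sum_i c i * q i k).
under eq_bigr => i _ do rewrite xE scaler_sumr.
rewrite exchange_big /=; apply: eq_bigr => k _.
rewrite rmorph_sum scaler_suml; apply: eq_bigr => i _.
by rewrite rmorphM scalerA.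
Qed.

End RationalSpan.

Section RationalSpanImage.
Variables (R : realType) (U : vectType R).
Implicit Types (s : seq U) (v : U).

Lemma spanQ_linear (U' : vectType R) (f : {linear U -> U'}) s (s' : seq U') v :
  (forall x, x \in s -> spanQ s' (f x)) -> spanQ s v -> spanQ s' (f v).
Proof.
move=> s_s' [c ->]; rewrite linear_sum /=.
under eq_bigr => i _ do rewrite linearZ /=.
by apply: spanQ_sum => i; apply: s_s'; apply: mem_nth.
Qed.

Lemma spanQ_coord n (e : n.-tuple U) v :
  free e -> spanQ e v -> forall k, rational (coord e k v).
Proof.
move=> e_free [c ->] k; rewrite linear_sum /=.
under eq_bigr do rewrite linearZ /=.
apply: rational_sum => i.
have lt_i : (i < n)%N by rewrite -[n in (_ < n)%N](size_tuple e).
rewrite -[nat_of_ord i]/(nat_of_ord (Ordinal lt_i)) coord_free //.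
by exists (Ordinal lt_i == k)%:R; rewrite // rmorph_nat.
Qed.

End RationalSpanImage.

(** * Orthogonal sums, traces and dual vectors *)

(** Directness makes the projections of a vector of [Vs j] vanish off [j], so
    pairing with [Vs j] only sees the component in [Vs j], where [b j] is
    nondegenerate. *)
Lemma orthogonal_sum_form (R : realType) (V : vectType R) (N : nat)
    (Vs : 'I_N -> {vspace V}) (b : forall j, {symmetric (subvs_of (Vs j))}) :
  directv (\sum_(j < N) Vs j)%VS -> (\sum_(j < N) Vs j)%VS = fullv ->
  (forall j, nondegenerate (b j)) ->
  exists f : {symmetric V}, nondegenerate f /\
    forall v w, f v w = orthogonal_sum (fun j => b j) v w.
Proof.
move=> Vs_direct Vs_full b_nondeg.
have [||f fE] := @symmetric_form_exists R V (orthogonal_sum (fun j => b j)).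
- move=> w a u v; rewrite /orthogonal_sum /= mulr_sumr -big_split.
  by apply: eq_bigr => j _ /=; rewrite !linearP linearPl.
- by move=> u v; apply: eq_bigr => j _ /=; rewrite symmetric_formC.
exists f; split=> //; apply/nondegenerateP => v v_rad.
pose pi := sumv_pi_for (erefl (\sum_(i < N) Vs i)%VS).
have {}fE u w :
    f u w = \sum_(j < N) b j (vsproj (Vs j) (pi j u)) (vsproj (Vs j) (pi j w)).
  exact: fE.
have pi_in j w : pi j w \in Vs j by apply: memv_sum_pi.
have pi_id j w i : w \in Vs j -> pi i w = if i == j then w else 0.
  move=> w_j; apply/eqP; move: (isT : predT i); move: i; apply/forall_inP.
  rewrite -(directv_sum_unique Vs_direct) => [|i _|i _]; last 2 first.
  - exact: pi_in.
  - by case: eqP => [->|_] //; apply: mem0v.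
  by rewrite sumv_pi_sum -?big_mkcond ?big_pred1_eq // Vs_full memvf.
have v0 j : pi j v = 0.
  suff /(congr1 vsval) : vsproj (Vs j) (pi j v) = 0.
    by rewrite vsprojK ?pi_in // linear0.
  apply: (nondegenerateP _ (b_nondeg j)) => w.
  have := v_rad (vsval w); rewrite fE (bigD1 j) //= big1.
    by rewrite addr0 (pi_id j (vsval w)) ?subvsP // eqxx vsvalK.
  move=> i /negPf i_j; rewrite (pi_id j (vsval w) i) ?subvsP // i_j.
  by rewrite [vsproj _ 0]linear0 linear0r.
have v_sum : \sum_(j < N) pi j v = v by rewrite sumv_pi_sum // Vs_full memvf.
by rewrite -v_sum big1 // => j _.
Qed.

Lemma product_form (F : fieldType) (U1 U2 : vectType F) (f1 : {symmetric U1})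
    (f2 : {symmetric U2}) :
  nondegenerate f1 -> nondegenerate f2 ->
  exists g : {symmetric (U1 * U2)%type}, nondegenerate g /\
    forall x y, g x y = f1 x.1 y.1 + f2 x.2 y.2.
Proof.
move=> /nondegenerateP f1_nondeg /nondegenerateP f2_nondeg.
have [||g gE] := @symmetric_form_exists F (U1 * U2)%type
  (fun x y => f1 x.1 y.1 + f2 x.2 y.2).
- by move=> y a x x' /=; rewrite !linearPl mulrDr addrACA.
- by move=> x y; rewrite symmetric_formC [f2 _ _]symmetric_formC.
exists g; split=> //; apply/nondegenerateP => -[x1 x2] x_rad; congr pair.
- by apply: f1_nondeg => y; have := x_rad (y, 0); rewrite gE /= linear0r addr0.
- by apply: f2_nondeg => y; have := x_rad (0, y); rewrite gE /= linear0r add0r.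
Qed.

(** The trace is defined through one particular basis; conjugation by the change
    of basis, written here as a matrix of the identity map, frees it from that
    choice. *)
Lemma lftrace_mxof (R : realType) (V : vectType R) (e : (\dim {:V}).-tuple V)
    (z : 'End(V)) :
  basis_of {:V} e -> lftrace z = \tr (mxof e e z).
Proof.
move=> e_basis; have b_basis := vbasisP {:V}; set b := vbasis _ in b_basis *.
have -> : mxof e e z =
    mxof e b \1 *m (mxof b b z *m mxof b e \1).
  by rewrite -!mxof_comp // comp_lfun1l comp_lfun1r.
rewrite mxtrace_mulC -mulmxA -mxof_comp // comp_lfun1l.
by rewrite mxof1 ?mulmx1 // (basis_free b_basis).
Qed.

(** The vector representing a linear functional, in coordinates; the formula
    has rational coordinates when the functional and the Gram matrix do. *)
Lemma vecof_dual (F : fieldType) (U : vectType F) (e : (\dim {:U}).-tuple U)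
    (f : {symmetric U}) (l : {scalar U}) (u : U) :
  basis_of {:U} e -> nondegenerate f ->
  f (vecof e ((\row_j l e`_j) *m invmx (gram e f))) u = l u.
Proof.
move=> e_basis f_nondeg; rewrite (formE e_basis) vecofK // mulmxKV; last first.
  by rewrite -nondegenerate_gram.
rewrite [u in RHS](coord_basis e_basis) ?memvf // linear_sum mxE.
by apply: eq_bigr => j _; rewrite !mxE linearZ mulrC.
Qed.

(** * The standard bracket and its structure constants *)

Section StandardBracket.
Variables (R : realType) (V : vectType R) (W : {vspace 'End(V)}).
Variables (E : (\dim {:subvs_of W}).-tuple (subvs_of W)).
Hypothesis E_basis : basis_of {:subvs_of W} E.
Variable bV : {symmetric V}.
Local Notation G := (V * subvs_of W)%type.
Implicit Types (v w : V) (z : subvs_of W).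

Definition bracket_row v w : 'rV[R]_(\dim {:subvs_of W}) :=
  \row_j bV (vsval E`_j v) w.

(** The element of [W] that represents [z |-> bV (z v) w] for the trace form,
    as soon as this form is nondegenerate. *)
Definition bracket_vec v w : subvs_of W :=
  vecof E (bracket_row v w *m invmx (gram E (trform W))).

Lemma bracket_rowl w : linear (bracket_row^~ w).
Proof. by move=> a v v'; apply/rowP=> j; rewrite !mxE linearP linearPl. Qed.

Lemma bracket_rowr v : linear (bracket_row v).
Proof. by move=> a w w'; apply/rowP=> j; rewrite !mxE linearPr. Qed.

Lemma trform_bracket_vec v w z :
  nondegenerate (trform W) -> trform W (bracket_vec v w) z = bV (vsval z v) w.
Proof.
move=> W_nondeg; pose l z := bV (vsval z v) w.
have l_linear : scalar l.
  by move=> a z1 z2; rewrite /l linearP add_lfunE scale_lfunE linearPl.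
pose lS : {scalar subvs_of W} :=
  HB.pack l (GRing.isLinear.Build R (subvs_of W) R *%R l l_linear).
exact: (@vecof_dual _ _ E (trform W) lS z E_basis W_nondeg).
Qed.

Lemma standard_bracket_exists :
  exists br : {bilinear G -> G -> G},
    forall x y, br x y = inr_prod V (bracket_vec x.1 y.1).
Proof.
pose br (x y : G) := inr_prod V (bracket_vec x.1 y.1).
have br_bil : bilinear_for *:%R *:%R br.
  split=> [y a x x'|x a y y']; rewrite /br /bracket_vec /=.
    by rewrite bracket_rowl mulmxDl -scalemxAl !linearP.
  by rewrite bracket_rowr mulmxDl -scalemxAl !linearP.
pose brB : {bilinear G -> G -> G} :=
  HB.pack br (bilinear_isBilinear.Build R G G G *:%R *:%R br br_bil).
by exists brB.
Qed.

Lemma standard_algebra_of_bracket (g : {symmetric G})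
    (br : {bilinear G -> G -> G}) :
  nondegenerate bV -> (forall z : 'End(V), z \in W -> skew_for bV z) ->
  nondegenerate (trform W) ->
  (forall x y, g x y = bV x.1 y.1 + trform W x.2 y.2) ->
  (forall x y, br x y = inr_prod V (bracket_vec x.1 y.1)) ->
  standard_pmetric_algebra g br.
Proof.
move=> bV_nondeg bV_skew W_nondeg gE brE; exists bV; split; first by split.
have row0l w : bracket_row 0 w = 0.
  by apply/rowP=> j; rewrite !mxE linear0 linear0l.
have row0r v : bracket_row v 0 = 0.
  by apply/rowP=> j; rewrite !mxE linear0r.
have br_2step (x y z : G) : br x (br y z) = 0.
  by rewrite !brE /= /bracket_vec row0r mul0mx !linear0.
split.
- move=> x; rewrite brE /bracket_vec.
  rewrite (_ : bracket_row _ _ = 0) ?mul0mx ?linear0 //.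
  (* A skew-symmetric map sends [v] to a vector orthogonal to [v]. *)
  apply/rowP=> j; rewrite !mxE; apply/eqP.
  have := bV_skew _ (subvsP E`_j) x.1 x.1.
  rewrite [X in - X]symmetric_formC => /eqP.
  by rewrite -addr_eq0 -mulr2n Num.Theory.mulrn_eq0.
- by move=> x y z; rewrite !br_2step !addr0.
- by move=> z x; rewrite brE /= /bracket_vec row0l mul0mx !linear0.
- move=> v w; rewrite brE; split=> // z /=.
  exact: trform_bracket_vec.
Qed.

End StandardBracket.

Section RationalBracket.
Variables (R : realType) (V : vectType R) (W : {vspace 'End(V)}).
Variables (B : (\dim {:V}).-tuple V).
Hypothesis B_basis : basis_of {:V} B.
Variables (E : (\dim {:subvs_of W}).-tuple (subvs_of W)).
Hypothesis E_basis : basis_of {:subvs_of W} E.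
Variables (A : 'I_(\dim {:subvs_of W}) -> 'M[rat]_(\dim {:V})).
Hypothesis A_E : forall k : 'I__, mxof B B (vsval E`_k) = map_mx ratr (A k).
Local Notation G := (V * subvs_of W)%type.

Lemma rational_trform_gram :
  exists T, gram E (trform W) = map_mx ratr T.
Proof.
exists (\matrix_(i, j) - \tr (A j *m A i)); apply/matrixP=> i j.
rewrite !mxE -[LHS]/(- lftrace _) (lftrace_mxof _ B_basis).
by rewrite (mxof_comp _ _ B_basis) // !A_E -map_mxM trace_map_mx rmorphN.
Qed.

(** In the basis [(B, 0), (0, E)] only brackets of two vectors of [B] survive;
    the functional [E_l |-> bV (E_l B_a) B_c] has values the entries of
    [A l *m S], and the inverse of the Gram matrix of the trace form, which
    turns these values into coordinates, is rational too. *)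
Lemma rational_basis_prod (bV : {symmetric V}) (S : 'M[rat]_(\dim {:V}))
    (br : {bilinear G -> G -> G}) :
  gram B bV = map_mx ratr S ->
  (forall x y, br x y = inr_prod V (bracket_vec E bV x.1 y.1)) ->
  exists (n : nat) (e : n.-tuple G),
    basis_of fullv e /\ rational_structure_constants br e.
Proof.
move=> bV_S brE.
have := basis_prod B_basis E_basis.
set s := _ ++ _ => s_basis; exists (size s), (in_tuple s); split=> // i j k.
apply: spanQ_coord; first exact: basis_free s_basis.
have s_E z : spanQ E z -> spanQ s (inr_prod V z).
  apply: spanQ_linear => x xE; apply: spanQ_mem.
  by rewrite mem_cat orbC map_f.
suff br_s u v : u \in s -> v \in s -> spanQ s (br u v).
  by apply: br_s; apply: mem_nth.
have s1 x : x \in s -> x.1 = 0 \/ exists a : 'I_(\dim {:V}), x.1 = B`_a.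
  rewrite mem_cat => /orP[] /mapP[w w_B ->]; [right|by left].
  have lt_v : (index w B < \dim {:V})%N.
    by rewrite -[X in (_ < X)%N](size_tuple B) index_mem.
  by exists (Ordinal lt_v); rewrite /= nth_index.
have [T TE] := rational_trform_gram.
suff row_rat x y : x \in s -> y \in s ->
    exists q, bracket_row E bV x.1 y.1 = map_mx ratr q.
  move=> /row_rat/[apply] -[q qE]; rewrite brE; apply: s_E.
  rewrite /bracket_vec qE TE -map_invmx -map_mxM /vecof.
  under eq_bigr => l _ do rewrite mxE.
  by apply: spanQ_sum => l; apply: spanQ_mem; rewrite mem_nth ?size_tuple.
move=> /s1 x1 /s1 y1.
case: x1 => [->|[a ->]].
  by exists 0; apply/rowP=> l; rewrite !mxE linear0 linear0l rmorph0.
case: y1 => [->|[c ->]].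
  by exists 0; apply/rowP=> l; rewrite !mxE linear0r rmorph0.
exists (\row_l (A l *m S) a c); apply/rowP => l; rewrite !mxE (formE B_basis).
rewrite (rVof_app B B_basis) !(rVofE B_basis) A_E bV_S.
rewrite -(mulmxA (delta_mx 0 a)) delta_form -map_mxM mxE.
by rewrite mxE.
Qed.

End RationalBracket.

(** * Existence of a rational basis *)

Theorem theorem7 (R : realType) (N : nat) (V : vectType R)
    (Vs : 'I_N -> {vspace V})
    (Vs_direct : directv (\sum_(j < N) Vs j)%VS)
    (Vs_full : (\sum_(j < N) Vs j)%VS = fullv)
    (b : forall j : 'I_N, {symmetric (subvs_of (Vs j))})
    (b_nondegenerate : forall j : 'I_N, nondegenerate (b j))
    (L : {vspace 'End(V)})
    (L_skew : forall z : 'End(V), z \in L ->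
       skew_for (orthogonal_sum (fun j => b j)) z)
    (L_subalgebra : lie_subalgebra L)
    (L_semisimple : lie_semisimple L)
    (m : nat) (C : m.-tuple 'End(V))
    (C_basis : basis_of L C)
    (C_rational : rational_structure_constants (@lfbracket R V) C)
    (W : {vspace 'End(V)})
    (W_sub : (W <= L)%VS)
    (W_rational : rational_subspace C W)
    (W_nondegenerate : nondegenerate (trform W))
    (W_preserves : forall (z : 'End(V)) (j : 'I_N), z \in W ->
       (z @: Vs j <= Vs j)%VS)
    (Vs_irreducible : forall j : 'I_N,
       irreducible_for (restrict (Vs j) @` [set z | z \in W]))
    (b_invariant : forall j : 'I_N,
       invariant_form (restrict (Vs j) @` [set z | z \in W]) (b j))
    (B_rational : forall j : 'I_N, exists (n : nat) (B : n.-tuple V),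
       basis_of (Vs j) B /\
       forall zeta : 'End(V), zeta \in C ->
         zeta @` spanQ B `<=` spanQ B) :
  exists (g : {symmetric (V * subvs_of W)%type})
         (br : {bilinear (V * subvs_of W)%type -> (V * subvs_of W)%type ->
                  (V * subvs_of W)%type}),
    [/\ nondegenerate g,
        standard_pmetric_algebra g br &
        exists (n : nat) (e : n.-tuple (V * subvs_of W)%type),
          basis_of fullv e /\ rational_structure_constants br e].
Proof.
have [B [B_basis B_C]] : exists B : (\dim {:V}).-tuple V, basis_of {:V} B /\
    forall (zeta : 'End(V)) v, zeta \in C -> v \in tval B -> spanQ B (zeta v).
  have {}B_rational j : exists s : seq V, basis_of (Vs j) s /\
      forall (zeta : 'End(V)) v, zeta \in C -> v \in s -> spanQ s (zeta v).
    have [n [s [s_basis s_C]]] := B_rational j; exists s.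
    split=> // zeta v zC vs.
    by apply: (s_C _ zC); exists v => //; apply: spanQ_mem.
  have [s sP] := choice B_rational.
  have := bigcat_basis Vs_direct (fun j _ => (sP j).1); rewrite Vs_full.
  move=> cat_basis; have [B BE] := basis_tuple cat_basis.
  exists B; rewrite BE; split=> // zeta v zC.
  have mem_cat_s w : (w \in \big[cat/[::]]_(j < N) s j) = [exists j, w \in s j].
    rewrite (big_morph (fun t => w \in t) (mem_cat w) (in_nil w)).
    by rewrite big_orE.
  rewrite mem_cat_s => /existsP[j v_j].
  have := (sP j).2 zeta v zC v_j.
  apply: (@spanQ_linear _ _ _ idfun) => w w_j.
  by apply: spanQ_mem; rewrite mem_cat_s; apply/existsP; exists j.
have [n [x [x_basis x_C]]] := W_rational.
have [E EE] := basis_tuple (basis_vsproj x_basis).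
have E_basis : basis_of {:subvs_of W} E by rewrite EE; apply: basis_vsproj.
have E_C z : z \in tval E -> spanQ C (vsval z).
  rewrite EE => /mapP[w w_x ->]; rewrite vsprojK ?(basis_mem x_basis) //.
  have lt_w : (index w x < n)%N.
    by rewrite -[X in (_ < X)%N](size_tuple x) index_mem.
  by have := x_C (Ordinal lt_w); rewrite /= nth_index.
have A_exists (k : 'I_(\dim {:subvs_of W})) : exists A : 'M[rat]_(\dim {:V}),
    mxof B B (vsval E`_k) = map_mx ratr A.
  apply: rational_mx => i j; rewrite mxE /= vecof_delta mxE.
  apply: spanQ_coord; first exact: basis_free B_basis.
  have [|c ->] := E_C E`_k; first by rewrite mem_nth ?size_tuple.
  rewrite sum_lfunE; under eq_bigr => l _ do rewrite scale_lfunE.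
  by apply: spanQ_sum => l; apply: B_C; rewrite mem_nth ?size_tuple.
have [A A_E] := choice A_exists.
have [f [f_nondeg fE]] := orthogonal_sum_form Vs_direct Vs_full b_nondegenerate.
(* The given form is a real solution of the rational linear system for Gram
   matrices of invariant forms. *)
have [||S [S_sym S_inv S_unit]] :=
  @rational_invariant_gram R _ _ A (gram B f) (gram_sym B f).
- move=> k; rewrite -A_E; apply/skew_gram => // u v; rewrite !fE.
  by apply/L_skew/(subvP W_sub)/subvsP.
- by rewrite -nondegenerate_gram.
have [bV bV_S] : exists bV : {symmetric V}, gram B bV = map_mx ratr S.
  by apply: form_of_gram; rewrite // map_trmx S_sym.
have bV_nondeg : nondegenerate bV.
  by rewrite (nondegenerate_gram B_basis) bV_S map_unitmx.
have bV_skew z : z \in W -> skew_for bV z.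
  move=> zW; apply/(skew_gram B_basis).
  have -> : z = \sum_k coord E k (vsproj W z) *: vsval E`_k.
    rewrite -[LHS](vsprojK zW) {1}(coord_basis E_basis (memvf (vsproj W z))).
    by rewrite linear_sum; apply: eq_bigr => k _; rewrite linearZ.
  rewrite linear_sum mulmx_suml raddf_sum mulmx_sumr -sumrN.
  apply: eq_bigr => k _.
  rewrite linearZ /= A_E linearZ /= -scalemxAl -scalemxAr bV_S.
  by rewrite -map_mxM S_inv map_mxN map_mxM map_trmx scalerN.
have [g [g_nondeg gE]] := product_form bV_nondeg W_nondegenerate.
have [br brE] := standard_bracket_exists E bV.
exists g, br; split=> //.
- exact: standard_algebra_of_bracket gE brE.
- exact: (rational_basis_prod B_basis E_basis A_E bV_S brE).
Qed.
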